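(* Let $h$ be a convex normal integrand on $\mathbb{R}^n\times\Omega$ and define on $L^\infty$ the functions $\phi(z)=\inf_{x\in\mathcal N}Eh(x+z)$ and $\tilde\phi(z)=\inf_{x\in\mathcal N^\infty}Eh(x+z)$. Assume that $\phi(0)$ is finite and $Eh$ is proper on $L^\infty$. Let $\mathcal A:=\operatorname{aff}(\operatorname{dom}Eh\cap L^\infty)$ and assume that there exists $\rho\in\mathbb{R}$ such that for every $z\in\mathcal A$ there exists $x\in\mathcal A\cap\mathcal N^\infty$ with $\|x-z\|\le\rho\|{}^az-z\|$. If $Eh$ is strongly continuous at a point of $\mathcal N^\infty$ relative to $\mathcal A$ (i.e. there is $\bar x\in\mathcal A\cap\mathcal N^\infty$ at which $Eh$ is finite and at which the restriction of $Eh$ to $\mathcal A$ is continuous with respect to the $L^\infty$-norm), then $\tilde\phi$ is strongly subdifferentiable at the origin, i.e. $\tilde\phi(0)$ is finite and there exists $v$ in the Banach dual $(L^\infty)^*$ of $L^\infty$ such that $\tilde\phi(z)\ge\tilde\phi(0)+v(z)$ for all $z\in L^\infty$.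
   Context: $(\Omega,\mathcal F,P)$ is a probability space with a filtration $(\mathcal F_t)_{t=0}^T$ (sub-$\sigma$-algebras of $\mathcal F$; $\mathcal F_T$ need not equal $\mathcal F$), and $n=n_0+\cdots+n_T$. $L^p:=L^p(\Omega,\mathcal F,P;\mathbb{R}^n)$ for $p\in\{0,\infty\}$; $\|\cdot\|$ is the $L^\infty$-norm. $\mathcal N=\{(x_t)_{t=0}^T \mid x_t\in L^0(\Omega,\mathcal F_t,P;\mathbb{R}^{n_t})\}$ and $\mathcal N^\infty:=\mathcal N\cap L^\infty$. $E_t$ is the conditional expectation with respect to $\mathcal F_t$, and ${}^ax$ is the adapted projection of $x\in L^\infty$: $({}^ax)_t=E_tx_t$. A normal integrand is a function $h:\mathbb{R}^n\times\Omega\to[-\infty,\infty]$ such that $\omega\mapsto\{(\xi,\alpha)\mid h(\xi,\omega)\le\alpha\}$ is a closed-valued $\mathcal F$-measurable set-valued mapping; it is convex if $h(\cdot,\omega)$ is convex for every $\omega$. For $x\in L^0$, $Eh(x)$ is the expectation of $\omega\mapsto h(x(\omega),\omega)$, where the expectation of a measurable function is defined as $+\infty$ unless its positive part is integrable. $\operatorname{dom}Eh=\{x\mid Eh(x)<\infty\}$. ''$Eh$ is proper on $L^\infty$'' means that $Eh>-\infty$ on $L^\infty$ and $Eh(z)<\infty$ for some $z\in L^\infty$. $\operatorname{aff}$ denotes the (algebraic) affine hull. *)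

(* Defs.v *)
From HB Require Import structures.
From mathcomp Require Import all_boot all_order all_algebra.
From mathcomp Require Import all_classical all_reals all_analysis.

Set Implicit Arguments.
Unset Strict Implicit.
Unset Printing Implicit Defensive.

Import Order.TTheory GRing.Theory Num.Theory.
Import numFieldNormedType.Exports.

Local Open Scope classical_set_scope.
Local Open Scope ring_scope.

Definition affine_hull (R : numDomainType) (V : lmodType R) (S : set V) : set V :=
  [set z | exists (k : nat) (a : 'I_k -> R) (y : 'I_k -> V),
     [/\ (forall i, S (y i)), \sum_(i < k) a i = 1 &
         z = \sum_(i < k) a i *: y i]].

Definition filtration (d : measure_display) (Omega : measurableType d)
    (N : nat) (F : 'I_N.+1 -> set (set Omega)) : Prop :=
  [/\ (forall t, sigma_algebra setT (F t)),
      (forall t, F t `<=` measurable) &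
      (forall s t : 'I_N.+1, (s <= t)%N -> F s `<=` F t)].

(* Measurability with respect to a sub-sigma-algebra [G], given as a set of
   sets; the measurable structure carried by the type [Omega] is not used. *)
Definition measurable_wrt (R : realType) (Omega : Type)
    (G : set (set Omega)) (f : Omega -> R) : Prop :=
  forall B : set R, measurable B -> G (f @^-1` B).

Section integrands.
Context (R : realType) (d : measure_display) (Omega : measurableType d).
Context (n : nat).
Implicit Types h : 'rV[R]_n -> Omega -> \bar R.

Definition epigraph h (w : Omega) : set ('rV[R]_n * R^o) :=
  [set p | (h p.1 w <= (p.2 : R)%:E)%E].

(* A set-valued mapping S is measurable when the preimage
   {w | S(w) meets O} of every open set O is measurable. *)
Definition normal_integrand h : Prop :=
  (forall w, closed (epigraph h w)) /\
  (forall O : set ('rV[R]_n * R^o), open O ->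
     measurable [set w | epigraph h w `&` O !=set0]).

(* For functions with values in [-oo, +oo], convexity is convexity of the
   epigraph. *)
Definition convex_integrand h : Prop := forall w, convex_set (epigraph h w).

End integrands.

Section random_vectors.
Context (R : realType) (d : measure_display) (Omega : measurableType d).
Context (P : probability Omega R).

(* Expectation with the convention that it is +oo unless the positive part is
   integrable (the library's \int is -oo when both parts have infinite
   integral). *)
Definition Eup (f : Omega -> \bar R) : \bar R :=
  if (\int[P]_w (f^\+ w) < +oo)%E then (\int[P]_w f w)%E else +oo%E.

Definition Eint (n : nat) (h : 'rV[R]_n -> Omega -> \bar R)
    (x : Omega -> 'rV[R]_n) : \bar R :=
  Eup (fun w => h (x w) w).

(* Elements of L^0 and L^oo are represented by functions, without passing to
   the quotient by P-almost sure equality. *)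
Definition L0 (n : nat) : set (Omega -> 'rV[R]_n) :=
  [set x | forall i, measurable_fun setT (fun w => x w ord0 i)].

(* `|x w| is the maximum norm of x w. *)
Definition Linf_norm (n : nat) (x : Omega -> 'rV[R]_n) : \bar R :=
  Lnorm P +oo%E (fun w => `|x w|%:E).

Definition Linf (n : nat) : set (Omega -> 'rV[R]_n) :=
  [set x | L0 x /\ (Linf_norm x < +oo)%E].

(* Only the restriction of v to Linf is relevant. The bound forces v to take
   the same value on almost surely equal functions, so these are exactly the
   continuous linear functionals on the Banach space of equivalence classes. *)
Definition Linf_dual (n : nat) (v : (Omega -> 'rV[R]_n) -> R) : Prop :=
  (forall (a : R) (x y : Omega -> 'rV[R]_n), Linf x -> Linf y ->
     v (a *: x + y) = a * v x + v y) /\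
  (exists C : R, forall x, Linf x -> (`|v x|%:E <= C%:E * Linf_norm x)%E).

Definition is_cond_exp (G : set (set Omega)) (f g : Omega -> R) : Prop :=
  [/\ measurable_wrt G g, P.-integrable setT (EFin \o g) &
      forall A, G A ->
        (\int[P]_(w in A) (g w)%:E = \int[P]_(w in A) (f w)%:E)%E].

(* A version of the conditional expectation of f given G; for integrable f it
   exists and is unique up to almost sure equality. *)
Definition cond_exp (G : set (set Omega)) (f : Omega -> R) : Omega -> R :=
  xget (fun=> 0) [set g | is_cond_exp G f g].

(* R^n with n = n_0 + ... + n_N is 'rV_(\sum_t n_ t), and the component x_t is
   the block submxrow x t. *)
Section processes.
Context (N : nat) (F : 'I_N.+1 -> set (set Omega)) (n_ : 'I_N.+1 -> nat).

Definition adapted : set (Omega -> 'rV[R]_(\sum_t n_ t)) :=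
  [set x | forall (t : 'I_N.+1) (i : 'I_(n_ t)),
     measurable_wrt (F t) (fun w => submxrow (x w) t ord0 i)].

Definition adapted_inf : set (Omega -> 'rV[R]_(\sum_t n_ t)) :=
  adapted `&` @Linf _.

Definition adapted_projection (z : Omega -> 'rV[R]_(\sum_t n_ t)) :
    Omega -> 'rV[R]_(\sum_t n_ t) :=
  fun w => \mxrow_t \row_i
    cond_exp (F t) (fun w' => submxrow (z w') t ord0 i) w.

End processes.

Definition proper_on_Linf (n : nat) (f : (Omega -> 'rV[R]_n) -> \bar R) : Prop :=
  (forall z, Linf z -> (-oo < f z)%E) /\
  (exists2 z, Linf z & (f z < +oo)%E).

Definition inf_over (n : nat) (f : (Omega -> 'rV[R]_n) -> \bar R)
    (D : set (Omega -> 'rV[R]_n)) (z : Omega -> 'rV[R]_n) : \bar R :=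
  ereal_inf [set f (x + z) | x in D].

Definition strongly_continuous_at_relative (n : nat)
    (f : (Omega -> 'rV[R]_n) -> \bar R) (A : set (Omega -> 'rV[R]_n))
    (x0 : Omega -> 'rV[R]_n) : Prop :=
  f x0 \is a fin_num /\
  forall e : R, 0 < e -> exists2 delta : R, 0 < delta &
    forall z, A z -> (Linf_norm (z - x0)%R < delta%:E)%E ->
      (`|f z - f x0| < e%:E)%E.

Definition strongly_subdifferentiable_at0 (n : nat)
    (f : (Omega -> 'rV[R]_n) -> \bar R) : Prop :=
  f 0 \is a fin_num /\
  exists2 v : (Omega -> 'rV[R]_n) -> R, Linf_dual v &
    forall z, Linf z -> (f 0%R + (v z)%:E <= f z)%E.

End random_vectors.

(* Main.v *)
(* Write m for the infimum of Eh over the bounded adapted processes. It suffices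
   to find v in the dual of L^oo with v z <= K ||z|| and v (y - x) <= Eh y - m
   for y in dom Eh and x bounded adapted; by Hahn-Banach such a v exists as soon
   as Eh y - m >= - K ||y - x||. For the latter, pick x' adapted in A with
   ||x' - y|| <= rho ||ay - y|| <= 2 rho ||y - x||, the second bound because
   conditional expectation is an L^oo contraction fixing x. For small l > 0 the
   point w = xbar + l (x' - y) of A lies in the ball around xbar on which Eh is
   bounded, and (w + l y) / (1 + l) is the adapted process
   (xbar + l x') / (1 + l); convexity of Eh then bounds Eh y from below. *)
Require Import Defs.
From HB Require Import structures.
From mathcomp Require Import all_boot all_order all_algebra.
From mathcomp Require Import all_classical all_reals all_analysis.
From mathcomp Require Import measurable_realfun ess_sup_inf ring lra.

Set Implicit Arguments.
Unset Strict Implicit.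
Unset Printing Implicit Defensive.

Import Order.TTheory GRing.Theory Num.Theory.
Import numFieldNormedType.Exports.

Local Open Scope classical_set_scope.
Local Open Scope ring_scope.

(** * Hahn-Banach theorems on a subspace, by Zorn's lemma *)

Section hahn_banach.
Context (R : realType) (V : lmodType R) (D : set V).

(** The space is a subset [D] of [V], with functionals defined on all of [V] but constrained on [D]
    only: this fits L^oo, which is a set of functions and not a type. *)
Definition subspace_set := D 0 /\ forall (a : R) x y, D x -> D y -> D (a *: x + y).

Definition sublinear_on (p : V -> R) :=
  (forall x y, D x -> D y -> p (x + y) <= p x + p y) /\
  (forall (a : R) x, 0 <= a -> D x -> p (a *: x) = a * p x).

Definition linear_on (v : V -> R) :=
  forall (a : R) x y, D x -> D y -> v (a *: x + y) = a * v x + v y.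

Hypothesis sD : subspace_set.

Lemma subspace_setD x y : D x -> D y -> D (x + y).
Proof. by move=> Dx Dy; rewrite -[x]scale1r; apply sD. Qed.

Lemma subspace_setZ a x : D x -> D (a *: x).
Proof. by move=> Dx; rewrite -[_ *: _]addr0; apply sD => //; case: sD. Qed.

Lemma subspace_setN x : D x -> D (- x).
Proof. by move=> Dx; rewrite -scaleN1r; apply: subspace_setZ. Qed.

Lemma subspace_setB x y : D x -> D y -> D (x - y).
Proof. by move=> Dx Dy; apply: subspace_setD => //; apply: subspace_setN. Qed.

Lemma sublinear_on0 p : sublinear_on p -> p 0 = 0.
Proof. by move=> [_ /(_ 0 0)]; rewrite scale0r mul0r => -> //; case: sD. Qed.

Lemma sublinear_onN p x : sublinear_on p -> D x -> - p (- x) <= p x.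
Proof.
move=> ps Dx; have := ps.1 x (- x) Dx (subspace_setN Dx).
by rewrite subrr sublinear_on0//; lra.
Qed.

(** Superadditivity turns subadditivity into additivity; additivity makes q odd, and oddness extends
    homogeneity to negative scalars. *)
Lemma sublinear_on_additive q : sublinear_on q ->
  (forall x z, D x -> D z -> q z + q x <= q (z + x)) -> linear_on q.
Proof.
move=> qs qa.
have qD x y : D x -> D y -> q (x + y) = q x + q y.
  by move=> Dx Dy; apply/eqP; rewrite eq_le qs.1// qa.
have qN x : D x -> q (- x) = - q x.
  move=> Dx; have := qD x (- x) Dx (subspace_setN Dx).
  by rewrite subrr sublinear_on0//; lra.
move=> a x y Dx Dy; rewrite qD//; last exact: subspace_setZ.
congr (_ + _); have [a0|a0] := leP 0 a; first exact: qs.2.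
rewrite -[a in LHS]opprK scaleNr qN; last exact: subspace_setZ.
by rewrite qs.2//; lra.
Qed.

(* A minimal sublinear functional below p is linear: replacing q by
   z |-> inf_(t >= 0) (q (z + t x) - t q x) cannot decrease it. *)
Lemma hahn_banach_sublinear p : sublinear_on p ->
  exists2 v, linear_on v & forall x, D x -> v x <= p x.
Proof.
move=> ps; pose S := {q : V -> R | sublinear_on q /\ forall x, D x -> q x <= p x}.
(* The order is reversed, so that a maximal element is a minimal functional. Values outside [D] are
   ignored, which leaves only a preorder. *)
pose rl (q1 q2 : S) := `[< forall x, D x -> sval q2 x <= sval q1 x >].
have p_in : sublinear_on p /\ forall x, D x -> p x <= p x by [].
pose p0 : S := exist _ p p_in.
have [| | |[q [qs qp]] qmin] := @ZL_preorder S p0 rl.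
- by move=> q; apply/asboolP.
- move=> q2 q1 q3 /asboolP h12 /asboolP h23; apply/asboolP => x Dx.
  exact: le_trans (h23 x Dx) (h12 x Dx).
- move=> A Atot.
  have [[q0 Aq0]|A0] := pselect (exists q, A q); last first.
    by exists p0 => s As; exfalso; apply: A0; exists s.
  (* A nonempty chain is bounded by its pointwise infimum, which is finite because each member at z
     is at least [- p (- z)]. *)
  pose I z := [set sval r z | r in A].
  have Ilb z : D z -> lbound (I z) (- p (- z)).
    move=> Dz _ [[r [rs rp]] _ <-] /=; apply: le_trans (sublinear_onN rs Dz).
    by rewrite lerN2 rp//; apply: subspace_setN.
  have Iinf z : D z -> has_inf (I z).
    move=> Dz; split; first by exists (sval q0 z), q0.
    by exists (- p (- z)); exact: Ilb.
  have Ile z r : D z -> A r -> inf (I z) <= sval r z.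
    by move=> Dz Ar; apply: ge_inf; [exact: (Iinf _ Dz).2|exists r].
  have qls : sublinear_on (fun z => inf (I z)).
    split=> [x y Dx Dy|a x a0 Dx].
      have Dxy := subspace_setD Dx Dy.
      rewrite -lerBlDr; apply: lb_le_inf; first exact: (Iinf _ Dx).1.
      move=> _ [r Ar <-]; rewrite lerBlDr -lerBlDl.
      apply: lb_le_inf; first exact: (Iinf _ Dy).1.
      move=> _ [s As <-]; rewrite lerBlDl.
      (* Here r was chosen for x and s for y; the smaller of the two functionals serves for both
         points. *)
      have [/asboolP rs|/asboolP sr] := Atot r s Ar As.
      - apply: le_trans (Ile _ _ Dxy As) _.
        by apply: le_trans ((svalP s).1.1 x y Dx Dy) _; rewrite lerD2r rs.
      - apply: le_trans (Ile _ _ Dxy Ar) _.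
        by apply: le_trans ((svalP r).1.1 x y Dx Dy) _; rewrite lerD2l sr.
    have Dax := @subspace_setZ a _ Dx.
    move: a0; rewrite le_eqVlt => /predU1P[<-|a0].
      rewrite scale0r mul0r.
      have -> : I 0 = [set 0].
        apply/seteqP; split=> [_ [[r [rs rp]] _ <-]|_ ->] /=.
          exact: sublinear_on0.
        by exists q0 => //; apply: sublinear_on0; exact: (svalP q0).1.
      exact: inf1.
    apply/eqP; rewrite eq_le; apply/andP; split.
      rewrite -ler_pdivrMl//; apply: lb_le_inf; first exact: (Iinf _ Dx).1.
      move=> _ [r Ar <-]; rewrite ler_pdivrMl//.
      by rewrite -(svalP r).1.2//; [exact: Ile|exact: ltW].
    apply: lb_le_inf; first exact: (Iinf _ Dax).1.
    move=> _ [r Ar <-]; rewrite (svalP r).1.2//; last exact: ltW.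
    by rewrite ler_pM2l//; exact: Ile.
  have qlp x : D x -> inf (I x) <= p x.
    by move=> Dx; apply: le_trans (Ile _ _ Dx Aq0) ((svalP q0).2 x Dx).
  exists (exist _ (fun z => inf (I z)) (conj qls qlp)) => s As.
  by apply/asboolP => x Dx; exact: Ile.
exists q => //; apply: sublinear_on_additive => // x z Dx Dz.
pose I z := [set q (z + t *: x) - t * q x | t in [set t | 0 <= t]].
have Ilb z' : D z' -> lbound (I z') (- q (- z')).
  move=> Dz' _ [t /= t0 <-]; rewrite lerBrDr -qs.2//.
  have := qs.1 (- z') (z' + t *: x) (subspace_setN Dz')
    (subspace_setD Dz' (subspace_setZ t Dx)).
  by rewrite addKr; lra.
have Iinf z' : D z' -> has_inf (I z').
  move=> Dz'; split; first by exists (q (z' + 0 *: x) - 0 * q x), 0 => /=.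
  by exists (- q (- z')); exact: Ilb.
have Ile z' t : D z' -> 0 <= t -> inf (I z') <= q (z' + t *: x) - t * q x.
  by move=> Dz' t0; apply: ge_inf; [exact: (Iinf _ Dz').2|exists t].
have Iq z' : D z' -> inf (I z') <= q z'.
  by move=> Dz'; have := Ile z' 0 Dz' (lexx _); rewrite scale0r addr0 mul0r subr0.
have Is : sublinear_on (fun z => inf (I z)).
  split=> [a b Da Db|a b a0 Db].
    have Dab := subspace_setD Da Db.
    rewrite -lerBlDr; apply: lb_le_inf; first exact: (Iinf _ Da).1.
    move=> _ [r /= r0 <-]; rewrite lerBlDr -lerBlDl.
    apply: lb_le_inf; first exact: (Iinf _ Db).1.
    move=> _ [s /= s0 <-]; rewrite lerBlDl.
    apply: le_trans (Ile _ _ Dab (addr_ge0 r0 s0)) _.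
    rewrite scalerDl addrACA.
    have := qs.1 (a + r *: x) (b + s *: x) (subspace_setD Da (subspace_setZ r Dx))
      (subspace_setD Db (subspace_setZ s Dx)).
    by lra.
  have Dab := @subspace_setZ a _ Db.
  move: a0; rewrite le_eqVlt => /predU1P[<-|a0].
    rewrite scale0r mul0r.
    have -> : I 0 = [set 0].
      apply/seteqP; split=> [_ [r /= r0 <-]|_ ->] /=.
        by rewrite add0r qs.2// subrr.
      by exists 0 => //=; rewrite scale0r addr0 sublinear_on0// mul0r subrr.
    exact: inf1.
  apply/eqP; rewrite eq_le; apply/andP; split.
    rewrite -ler_pdivrMl//; apply: lb_le_inf; first exact: (Iinf _ Db).1.
    move=> _ [r /= r0 <-]; rewrite ler_pdivrMl//.
    (* Rescaling the parameter from r to [a * r] lets the factor a be pulled out of q. *)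
    apply: le_trans (Ile _ (a * r) Dab (mulr_ge0 (ltW a0) r0)) _.
    rewrite -scalerA -scalerDr qs.2; [lra|exact: ltW|].
    by apply: subspace_setD => //; exact: subspace_setZ.
  apply: lb_le_inf; first exact: (Iinf _ Dab).1.
  move=> _ [r /= r0 <-]; rewrite -ler_pdivlMl//.
  apply: le_trans (Ile _ (a^-1 * r) Db _) _.
    by rewrite mulr_ge0// invr_ge0 ltW.
  have -> : b + (a^-1 * r) *: x = a^-1 *: (a *: b + r *: x).
    by rewrite scalerDr !scalerA mulVf ?scale1r// gt_eqF.
  rewrite qs.2; [by rewrite mulrBr mulrA|by rewrite invr_ge0 ltW|].
  by apply: subspace_setD => //; exact: subspace_setZ.
have Ip z' : D z' -> inf (I z') <= p z'.
  by move=> Dz'; apply: le_trans (Iq _ Dz') (qp _ Dz').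
(* Minimality puts q below the infimum, and the parameter t = 1 then gives superadditivity. *)
have /asboolP/(_ z Dz)/= qI :=
    qmin (exist _ (fun z => inf (I z)) (conj Is Ip)) (introT (asboolP _) Iq).
have := le_trans qI (Ile z 1 Dz ler01).
by rewrite scale1r mul1r; lra.
Qed.

(* The functional is dominated by z |-> inf (a + g (z - u)), the infimum being
   over the convex cone generated by the pairs (u, a) in C. *)
Lemma hahn_banach_sandwich (g : V -> R) (C : set (V * R)) :
  sublinear_on g -> C !=set0 ->
  (forall z a, C (z, a) -> D z) ->
  (forall z a, C (z, a) -> - g (- z) <= a) ->
  (forall z a z' a' (s s' : R), C (z, a) -> C (z', a') -> 0 < s -> 0 < s' ->
     s + s' = 1 -> C (s *: z + s' *: z', s * a + s' * a')) ->
  exists2 v, linear_on v & (forall z, D z -> v z <= g z) /\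
    (forall z a, C (z, a) -> v z <= a).
Proof.
move=> gs [[c0 a0] C0] CD Cg Cc.
pose K := [set x : V * R | exists s z a, [/\ 0 <= s, C (z, a) &
  x = (s *: z, s * a)]].
have KD z a : K (z, a) -> D z.
  by move=> [s [z' [a' [s0 /CD Dz' [-> _]]]]]; exact: subspace_setZ.
have KC z a : C (z, a) -> K (z, a).
  by move=> Cz; exists 1, z, a; rewrite scale1r mul1r.
have K0 : K (0, 0) by exists 0, c0, a0; rewrite scale0r mul0r.
have Kg z a : K (z, a) -> - g (- z) <= a.
  move=> [s [z' [a' [s0 Cz' [-> ->]]]]].
  rewrite -scalerN gs.2//; last exact/subspace_setN/(CD _ _ Cz').
  by rewrite -mulrN ler_wpM2l// Cg.
have KZ z a s : 0 <= s -> K (z, a) -> K (s *: z, s * a).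
  move=> s0 [t [z' [a' [t0 Cz' [-> ->]]]]]; exists (s * t), z', a'.
  by rewrite mulr_ge0// scalerA mulrA.
have KA z a z' a' : K (z, a) -> K (z', a') -> K (z + z', a + a').
  move=> [s [u [b [s0 Cu [-> ->]]]]] [t [u' [b' [t0 Cu' [-> ->]]]]].
  (* Convexity of [C] is available for positive weights only, so zero multiples are split off;
     otherwise the sum is [s + t] times a convex combination. *)
  move: s0; rewrite le_eqVlt => /predU1P[<-|s0].
    by rewrite scale0r mul0r !add0r; exists t, u', b'.
  move: t0; rewrite le_eqVlt => /predU1P[<-|t0].
    by rewrite scale0r mul0r !addr0; exists s, u, b; rewrite ltW.
  have st0 : 0 < s + t by exact: addr_gt0.
  exists (s + t), ((s / (s + t)) *: u + (t / (s + t)) *: u'),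
    ((s / (s + t)) * b + (t / (s + t)) * b'); split; first exact: ltW.
  - by apply: Cc => //; rewrite ?divr_gt0// -mulrDl divff// gt_eqF.
  - have e r : (s + t) * (r / (s + t)) = r by rewrite mulrC mulfVK ?gt_eqF.
    congr (_, _); first by rewrite scalerDr !scalerA !e.
    by rewrite mulrDr; congr (_ + _); rewrite [RHS]mulrA e.
pose I z := [set x.2 + g (z - x.1) | x in K].
have Ilb z : D z -> lbound (I z) (- g (- z)).
  move=> Dz _ [[u a] /= Ku <-].
  have Du := KD _ _ Ku.
  (* Subadditivity for - u = (z - u) - z, together with [- g (- u) <= a], keeps the infimum
     finite. *)
  have := gs.1 (z - u) (- z) (subspace_setB Dz Du) (subspace_setN Dz).
  rewrite [z - u + _]addrAC subrr add0r; have := Kg _ _ Ku; lra.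
have Iinf z : D z -> has_inf (I z).
  move=> Dz; split; last by exists (- g (- z)); exact: Ilb.
  by exists (0 + g (z - 0)), (0, 0).
have Ile z u a : D z -> K (u, a) -> inf (I z) <= a + g (z - u).
  by move=> Dz Ku; apply: ge_inf; [exact: (Iinf _ Dz).2|exists (u, a)].
have g0 : g 0 = 0 by exact: sublinear_on0.
have [] := @hahn_banach_sublinear (fun z => inf (I z)).
  split=> [x y Dx Dy|a x a_ge0 Dx].
    have Dxy := subspace_setD Dx Dy.
    rewrite -lerBlDr; apply: lb_le_inf; first exact: (Iinf _ Dx).1.
    move=> _ [[u a] /= Ku <-]; rewrite lerBlDr -lerBlDl.
    apply: lb_le_inf; first exact: (Iinf _ Dy).1.
    move=> _ [[w b] /= Kw <-]; rewrite lerBlDl.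
    apply: le_trans (Ile _ _ _ Dxy (KA _ _ _ _ Ku Kw)) _.
    have := gs.1 (x - u) (y - w) (subspace_setB Dx (KD _ _ Ku))
      (subspace_setB Dy (KD _ _ Kw)).
    by rewrite opprD addrACA; lra.
  have Dax := @subspace_setZ a _ Dx.
  move: a_ge0; rewrite le_eqVlt => /predU1P[<-|a_gt0].
    rewrite scale0r mul0r; have D00 : D 0 by case: sD.
    apply/eqP; rewrite eq_le; apply/andP; split.
      by have := Ile 0 0 0 D00 K0; rewrite subr0 g0 addr0.
    apply: lb_le_inf; first exact: (Iinf _ D00).1.
    by have := Ilb 0 D00; rewrite oppr0 g0 oppr0.
  apply/eqP; rewrite eq_le; apply/andP; split.
    rewrite -ler_pdivrMl//; apply: lb_le_inf; first exact: (Iinf _ Dx).1.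
    move=> _ [[u b] /= Ku <-]; rewrite ler_pdivrMl//.
    apply: le_trans (Ile _ _ _ Dax (KZ _ _ _ (ltW a_gt0) Ku)) _.
    rewrite -scalerBr gs.2; [by rewrite mulrDr|exact: ltW|].
    exact: subspace_setB (KD _ _ Ku).
  apply: lb_le_inf; first exact: (Iinf _ Dax).1.
  move=> _ [[u b] /= Ku <-]; rewrite -ler_pdivlMl//.
  have ai : 0 <= a^-1 by rewrite invr_ge0 ltW.
  apply: le_trans (Ile _ _ _ Dx (KZ _ _ _ ai Ku)) _.
  have -> : x - a^-1 *: u = a^-1 *: (a *: x - u).
    by rewrite scalerBr !scalerA mulVf ?scale1r// gt_eqF.
  rewrite gs.2//; first by rewrite mulrDr.
  exact: subspace_setB (KD _ _ Ku).
(* The two bounds come from the cone elements (0, 0) and (z, a), the latter with g 0 = 0. *)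
move=> v vl vI; exists v => //; split=> [z Dz|z a Cz].
  by have := le_trans (vI _ Dz) (Ile _ _ _ Dz K0); rewrite subr0 add0r.
have Dz := CD _ _ Cz.
by have := le_trans (vI _ Dz) (Ile _ _ _ Dz (KC _ _ Cz)); rewrite subrr g0 addr0.
Qed.

End hahn_banach.

(** * Measurability of a normal integrand along a random vector *)

Section normal_integrands.
Context (R : realType) (d : measure_display) (Omega : measurableType d).
Context (n : nat).
Implicit Types (h : 'rV[R]_n -> Omega -> \bar R) (x : Omega -> 'rV[R]_n).

(* As epigraphs are closed, h (x w) w <= a iff, for every k, some rational point
   q is e k-close to x w while the epigraph meets the e k-ball around (q, a). *)
Lemma measurable_normal_integrand h x : normal_integrand h -> L0 x ->
  measurable_fun setT (fun w => h (x w) w : \bar R).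
Proof.
move=> [hc hm] mx _.
apply: (measurability _ (ErealGenOInfty.measurableE R)) => // _ [_ [a ->] <-].
rewrite setTI.
pose e (k : nat) : R := k.+1%:R^-1.
have e0 k : 0 < e k by rewrite /e invr_gt0.
pose rv (q : 'rV[rat]_n) : 'rV[R]_n := map_mx ratr q.
pose B k (q : 'rV[rat]_n) := (\bigcap_(i in [set: 'I_n])
    [set w | `|x w ord0 i - ratr (q ord0 i)| < e k]) `&`
  [set w | epigraph h w `&` ball ((rv q, a) : 'rV[R]_n * R^o) (e k) !=set0].
suff -> : (fun w => h (x w) w) @^-1` `]a%:E, +oo[ =
    ~` \bigcap_k \bigcup_q B k q.
  apply: measurableC; apply: bigcapT_measurable => k.
  apply: countable_bigcupT_measurable => [|q]; first exact: countableP.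
  apply: measurableI; last exact/hm/ball_open.
  apply: fin_bigcap_measurable => [|i _]; first exact: finite_finset.
  have mi : measurable_fun setT (fun w => `|x w ord0 i - ratr (q ord0 i)|).
    by apply: measurableT_comp => //; apply: measurable_funB.
  rewrite -[X in measurable X]setTI.
  have -> : [set w | `|x w ord0 i - ratr (q ord0 i)| < e k] =
    (fun w => `|x w ord0 i - ratr (q ord0 i)|) @^-1` `]-oo, (e k)[.
    by apply/seteqP; split => w /=; rewrite in_itv.
  exact: mi.
apply: setC_inj; rewrite setCK; apply/seteqP; split=> w /=.
  rewrite in_itv/= andbT => /negP; rewrite -leNgt => hxa k _.
  have /choice[q qx] : forall i : 'I_n, exists q : rat,
      `|x w ord0 i - ratr q| < e k.
    move=> i.
    have [|q] := @rat_in_itvoo R (x w ord0 i - e k) (x w ord0 i + e k).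
      by have := e0 k; lra.
    by rewrite in_itv/= => /andP[? ?]; exists q; rewrite ltr_norml; lra.
  exists (\row_i q i) => //; split=> [i _ /=|]; first by rewrite mxE.
  exists (x w, a) => /=; split => //; split => /=; last exact: ballxx.
  split=> // i j; rewrite !mxE ord1 -ball_normE /ball_ /= distrC.
  exact: qx.
move=> Bw; rewrite in_itv/= andbT; apply/negP; rewrite -leNgt.
have : closure (epigraph h w) (x w, a).
  move=> U /nbhs_ballP[r /= r0 rU].
  (* Half the radius suffices because the rational point q sits between [x w] and the epigraph
     point, within [e k] of each. *)
  have [k kr] : exists k, e k < r / 2.
    have r20 : 0 < r / 2 by rewrite divr_gt0.
    have [k _ /(_ k (leqnn k))] := near_infty_natSinv_lt (PosNum r20).
    by exists k.
  have [q _ [/= qx [[y b] /= [hyb [yq bq]]]]] := Bw k I.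
  exists (y, b); split => //; apply: rU; split => /=; last first.
    by apply: le_ball bq; have := e0 k; lra.
  split=> // i j; rewrite ord1.
  have := qx j I; have := yq.2 ord0 j; rewrite mxE -!ball_normE /ball_ /= => h1 h2.
  rewrite (le_lt_trans (ler_distD (ratr (q ord0 j)) _ _))//.
  by rewrite (splitr r) ltrD// (lt_trans _ kr).
by rewrite -(closure_id _).1//; exact: hc.
Qed.

End normal_integrands.

(** * Convexity of the integral functional *)

Section convex_expectation.
Context (R : realType) (d : measure_display) (Omega : measurableType d).
Context (n : nat).
Implicit Types (h : 'rV[R]_n -> Omega -> \bar R) (x y : Omega -> 'rV[R]_n).

(** Epigraph points have real ordinates; finiteness of both values provides them. *)
Lemma convex_integrand_le h (w : Omega) (x y : 'rV[R]_n) (a b : R) :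
  convex_integrand h -> 0 <= a -> 0 <= b -> a + b = 1 ->
  h x w \is a fin_num -> h y w \is a fin_num ->
  (h (a *: x + b *: y)%R w <= a%:E * h x w + b%:E * h y w)%E.
Proof.
move=> ch a0 b0 ab fx fy; have a1 : a <= 1 by lra.
have bE : b = 1 - a by lra.
have := ch w (x, fine (h x w)) (y, fine (h y w)) (Itv01 a0 a1).
rewrite !inE /epigraph/= !fineK// => /(_ (lexx _) (lexx _)).
rewrite EFinD !EFinM !fineK// bE /=.
exact.
Qed.

Context (P : probability Omega R).

(** A finite value excludes the default [+oo], so the positive part is integrable; an infinite
    integral of the negative part would then force [-oo]. *)
Lemma Eup_fin_num (f : Omega -> \bar R) : measurable_fun setT f ->
  Eup P f \is a fin_num ->
  P.-integrable setT f /\ Eup P f = (\int[P]_w f w)%E.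
Proof.
rewrite /Eup => mf; case: ifPn => // fp ffin; split => //.
apply/integrableP; split => //.
have -> : (fun w => `|f w|%E) = (f^\+ \+ f^\-)%E by rewrite -fune_abse.
rewrite ge0_integralD//; [|exact: measurable_funepos|exact: measurable_funeneg].
rewrite lte_add_pinfty// ltey; apply/negP => /eqP fn.
move: ffin; rewrite integralE fn.
by rewrite addeNy.
Qed.

(* The positive and negative parts are compared separately, so the function on
   the left need not be integrable. *)
Lemma Eup_le_ae (f g : Omega -> \bar R) : measurable_fun setT f ->
  P.-integrable setT g -> {ae P, forall w, (f w <= g w)%E} ->
  (Eup P f <= \int[P]_w g w)%E.
Proof.
move=> mf ig fg; have mg := measurable_int _ ig.
have fgp : (\int[P]_w f^\+ w <= \int[P]_w g^\+ w)%E.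
  apply: ae_ge0_le_integral => //; [exact: measurable_funepos..|].
  apply: filterS fg => w fgw _; rewrite !funeposE.
  by rewrite ge_max !le_max fgw lexx orbT.
have gfn : (\int[P]_w g^\- w <= \int[P]_w f^\- w)%E.
  apply: ae_ge0_le_integral => //; [exact: measurable_funeneg..|].
  apply: filterS fg => w fgw _; rewrite !funenegE.
  by rewrite ge_max !le_max leeN2 fgw lexx orbT.
rewrite /Eup (le_lt_trans fgp); last exact: integral_funepos_lt_pinfty.
by rewrite integralE [leRHS]integralE leeB.
Qed.

(** Finite expectations make both compositions integrable, hence finite almost everywhere, and there
    pointwise convexity applies. *)
Lemma Eint_convex h x y (a b : R) : normal_integrand h -> convex_integrand h ->
  L0 x -> L0 y -> 0 <= a -> 0 <= b -> a + b = 1 ->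
  Eint P h x \is a fin_num -> Eint P h y \is a fin_num ->
  (Eint P h (a *: x + b *: y)%R <= a%:E * Eint P h x + b%:E * Eint P h y)%E.
Proof.
move=> nh ch mx my a0 b0 ab fx fy.
have mhx := measurable_normal_integrand nh mx.
have mhy := measurable_normal_integrand nh my.
have [ix Ex] := Eup_fin_num mhx fx; have [iy Ey] := Eup_fin_num mhy fy.
have iax := integrableZl measurableT a ix.
have iby := integrableZl measurableT b iy.
rewrite [Eint P h x]Ex [Eint P h y]Ey -!integralZl// -integralD//.
apply: Eup_le_ae.
- apply: (@measurable_normal_integrand _ _ _ _ h (a *: x + b *: y)) => // i.
  have -> : (fun w => (a *: x + b *: y) w ord0 i) =
      ((fun w => a * x w ord0 i) \+ (fun w => b * y w ord0 i))%R.
    by apply/funext => w /=; rewrite !mxE.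
  by apply: measurable_funD; apply: measurable_funM.
- exact: integrableD.
- have := integrable_ae measurableT iy; have := integrable_ae measurableT ix.
  apply: filterS2 => w hx hy.
  by apply: convex_integrand_le => //; [exact: hx|exact: hy].
Qed.

End convex_expectation.

(** * Conditional expectation: existence and contraction in L^oo *)

Section conditional_expectation.
Context (R : realType) (d : measure_display) (Omega : measurableType d).
Context (P : probability Omega R).
Context (G : set (set Omega)).
Hypotheses (sG : sigma_algebra setT G) (GM : G `<=` measurable).
Implicit Types (f g : Omega -> R).

(** A copy of [Omega] carrying [G] as its measurable structure, so that results on measurable
    functions apply to [measurable_wrt G]. *)
Let T' := g_sigma_algebraType G.

Lemma measurable_wrtP f :
  measurable_wrt G f <-> measurable_fun setT (f : T' -> R).
Proof.
split=> [mf _ B mB|mf B mB].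
  by rewrite setTI; apply: sub_sigma_algebra; exact: mf.
have := mf measurableT B mB; rewrite setTI /measurable/=.
by rewrite sigma_algebra_id.
Qed.

Lemma measurable_wrt_fun f : measurable_wrt G f -> measurable_fun setT f.
Proof. by move=> mf _ B mB; rewrite setTI; apply/GM/mf. Qed.

(** By Radon-Nikodym: on [G], the charge sending A to the integral of f over A is dominated by the
    restriction of P, and its density is the required g. The identity map from [Omega] to [T']
    transports both. *)
Lemma is_cond_exp_ex f : P.-integrable setT (EFin \o f) ->
  exists g, is_cond_exp P G f g.
Proof.
move=> intf.
have mid : measurable_fun setT (idfun : Omega -> T').
  by move=> _ B; rewrite /measurable/= sigma_algebra_id// setTI => /GM.
pose X : {mfun Omega >-> T'} :=
  HB.pack (idfun : Omega -> T') (isMeasurableFun.Build _ _ _ _ _ mid).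
pose mu : {sigma_finite_measure set T' -> \bar R} := distribution P X.
unshelve epose (nu := (pushforward (induced_charge intf) (idfun : Omega -> T')
  : {charge set T' -> \bar R})); first exact: mid.
have numu : nu `<< mu.
  apply/null_content_dominatesP => A mA A0.
  have mA' : measurable (A : set Omega).
    by move: mA; rewrite /measurable/= sigma_algebra_id// => /GM.
  apply: null_set_integral => //.
  by apply: measurable_funTS; exact: measurable_int intf.
pose g := Radon_Nikodym nu mu.
have gE w : (fine (g w))%:E = g w by rewrite fineK// Radon_Nikodym_fin_num.
have ig := Radon_Nikodym_integrable numu.
have mg : measurable_fun setT g by exact: measurable_int ig.
have gid : EFin \o (fine \o g) = g by apply/funext => w /=; rewrite gE.
have igP : P.-integrable setT (EFin \o (fine \o g)).
  rewrite gid; apply/integrableP; split.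
    by apply: (measurable_comp measurableT _ mg mid).
  have /integrableP[_] := ig.
  by rewrite (ge0_integral_pushforward mid)//; exact: measurableT_comp.
exists (fine \o g); split => //.
  by apply/measurable_wrtP; apply: measurableT_comp.
move=> A GA; have mA : measurable (A : set T') by exact: sub_sigma_algebra.
have -> : (\int[P]_(w in A) (f w)%:E)%E = nu A by [].
rewrite (Radon_Nikodym_integral numu mA) (integral_pushforward mid)//.
  by apply: eq_integral => w _; rewrite /= gE.
by rewrite gid in igP; apply: integrableS igP => //; exact: GM.
Qed.

Lemma cond_expP f : P.-integrable setT (EFin \o f) ->
  is_cond_exp P G f (cond_exp P G f).
Proof. by move=> /is_cond_exp_ex; exact: xgetPex. Qed.

Lemma is_cond_expN f E : P.-integrable setT (EFin \o f) ->
  is_cond_exp P G f E -> is_cond_exp P G (fun w => - f w) (fun w => - E w).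
Proof.
move=> intf [mE iE EA]; split.
- apply/measurable_wrtP; apply: measurableT_comp => //.
  exact/measurable_wrtP.
- exact: (@integrableN _ _ _ P setT (EFin \o E) iE).
- move=> A GA; have mA := GM GA.
  have iN (u : Omega -> R) : P.-integrable setT (EFin \o u) ->
      (\int[P]_(w in A) (- u w)%:E = - \int[P]_(w in A) (u w)%:E)%E.
    move=> iu; under eq_integral do rewrite EFinN.
    by apply: integralN; apply: integrable_add_def => //; exact: integrableS iu.
  by rewrite !iN// EA.
Qed.

(** On the [G]-set where E > g + c, the integral of E - (g + c) equals that of f - (g + c), which is
    nonpositive. A positive integrand with such an integral lives on a null set. *)
Lemma is_cond_exp_le f E g (c : R) : P.-integrable setT (EFin \o f) ->
  is_cond_exp P G f E ->
  P.-integrable setT (EFin \o g) -> measurable_wrt G g ->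
  {ae P, forall w, f w <= g w + c} -> {ae P, forall w, E w <= g w + c}.
Proof.
move=> intf [mE iE EA] intg mg fgc.
have mgc : measurable_wrt G (fun w => E w - (g w + c)).
  apply/measurable_wrtP; apply: measurable_funB; first exact/measurable_wrtP.
  by apply: measurable_funD => //; exact/measurable_wrtP.
pose A := (fun w => E w - (g w + c)) @^-1` `]0, +oo[.
have GA : G A by apply: mgc; exact: measurable_itv.
have mA : measurable A by exact: GM.
have igc : P.-integrable setT (EFin \o (fun w => g w + c)).
  have -> : EFin \o (fun w => g w + c) = ((EFin \o g) \+ (EFin \o cst c))%E by [].
  by apply: integrableD => //; exact: finite_measure_integrable_cst.
have sub (u : Omega -> R) : P.-integrable setT (EFin \o u) ->
  P.-integrable A (EFin \o u) by apply: integrableS.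
have EgA : (\int[P]_(w in A) (E w - (g w + c))%:E <= 0)%E.
  under eq_integral do rewrite EFinB.
  rewrite integralB//; [|exact: sub..].
  rewrite EA// -integralB//; [|exact: sub..].
  rewrite integralE sube_le0.
  apply: (@le_trans _ _ 0%E); last exact: integral_ge0.
  rewrite le_eqVlt; apply/orP; left; apply/eqP.
  have mu1 : measurable_fun A (fun w => (f w)%:E - (g w + c)%:E)%E.
    by apply: emeasurable_funB; apply: (measurable_int P); exact: sub.
  rewrite (ae_eq_integral (cst 0%E))//; first exact: integral0.
    exact: measurable_funepos.
  apply: filterS fgc => w fgw _; rewrite funeposE /=; apply/max_idPr.
  by rewrite -EFinB lee_fin subr_le0.
have : ae_eq P A (fun w => (E w - (g w + c))%:E) (cst 0%E).
  apply/ae_eq_integral_abs => //.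
    apply/measurable_EFinP; apply: measurable_funTS.
    exact: measurable_wrt_fun.
  apply/eqP; rewrite eq_le integral_ge0// andbT.
  apply: le_trans EgA; rewrite le_eqVlt; apply/orP; left; apply/eqP.
  apply: eq_integral => w /set_mem.
  by rewrite /A /= in_itv/= andbT => /ltW h; rewrite ger0_norm.
apply: filterS => w h; rewrite leNgt; apply/negP => lt.
have Aw : A w by rewrite /A /= in_itv/= andbT subr_gt0.
by have := h Aw => -[] /eqP; rewrite subr_eq0 => /eqP e; rewrite e ltxx in lt.
Qed.

(** This is the L^oo contraction property around a [G]-measurable g; the one-sided comparison is
    applied to f and to - f. *)
Lemma cond_exp_dist f g (c : R) : P.-integrable setT (EFin \o f) ->
  P.-integrable setT (EFin \o g) -> measurable_wrt G g ->
  {ae P, forall w, `|f w - g w| <= c} ->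
  {ae P, forall w, `|cond_exp P G f w - g w| <= c}.
Proof.
move=> intf intg mg fgc; have cE := cond_expP intf.
have le : {ae P, forall w, cond_exp P G f w <= g w + c}.
  apply: (is_cond_exp_le intf) => //.
  by apply: filterS fgc => w; rewrite ler_norml => /andP[_]; lra.
have ge : {ae P, forall w, - cond_exp P G f w <= - g w + c}.
  apply: (@is_cond_exp_le (fun w => - f w) (fun w => - cond_exp P G f w)
    (fun w => - g w)).
  - exact: (@integrableN _ _ _ P setT (EFin \o f) intf).
  - exact: is_cond_expN.
  - exact: (@integrableN _ _ _ P setT (EFin \o g) intg).
  - apply/measurable_wrtP; apply: measurableT_comp => //.
    exact/measurable_wrtP.
  - by apply: filterS fgc => w; rewrite ler_norml => /andP[+ _]; lra.
apply: filterS2 le ge => w lew gew; rewrite ler_norml; lra.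
Qed.

End conditional_expectation.

(** * Affine combinations inside an affine hull *)

Section affine_hulls.
Context (R : realType) (V : lmodType R).
Implicit Types S : set V.

Lemma subset_affine_hull S : S `<=` affine_hull S.
Proof.
move=> x Sx; exists 1%N, (fun=> 1), (fun=> x); split => //.
  by rewrite big_ord1.
by rewrite big_ord1 scale1r.
Qed.

Lemma affine_hull_comb S x y (a b : R) : affine_hull S x -> affine_hull S y ->
  a + b = 1 -> affine_hull S (a *: x + b *: y).
Proof.
move=> [k [p [u [Su p1 ->]]]] [l [q [v [Sv q1 ->]]]] ab.
exists (k + l)%N,
  (fun i => match fintype.split i with inl j => a * p j | inr j => b * q j end),
  (fun i => match fintype.split i with inl j => u j | inr j => v j end).
split.
- by move=> i; case: fintype.split.
- rewrite big_split_ord/=.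
  under eq_bigr do rewrite (unsplitK (inl _)).
  under [X in _ + X]eq_bigr do rewrite (unsplitK (inr _)).
  by rewrite -!mulr_sumr p1 q1 !mulr1.
- rewrite big_split_ord/=.
  under [in RHS]eq_bigr do rewrite (unsplitK (inl _)).
  under [X in _ = _ + X]eq_bigr do rewrite (unsplitK (inr _)).
  by rewrite !scaler_sumr; congr (_ + _); apply: eq_bigr => i _; rewrite scalerA.
Qed.

(** The coefficients 1, a and - a sum to 1. Binary combinations reach this one by doubling the
    midpoint of x and [a *: y + (1 - a) *: z], then subtracting z. *)
Lemma affine_hull_translate S x y z (a : R) : affine_hull S x ->
  affine_hull S y -> affine_hull S z -> affine_hull S (x + a *: (y - z)).
Proof.
move=> Ax Ay Az.
have -> : x + a *: (y - z) =
    2 *: (2^-1 *: x + 2^-1 *: (a *: y + (1 - a) *: z)) + (- 1) *: z.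
  rewrite scalerBr [2 *: _]scalerDr !scalerA divff// !scale1r scaleN1r.
  rewrite scalerBl scale1r -!addrA; congr (_ + (_ + _)).
  by rewrite addrCA subrr addr0.
apply: affine_hull_comb => //; last by lra.
apply: affine_hull_comb => //; last by lra.
by apply: affine_hull_comb => //; lra.
Qed.

End affine_hulls.

(** * The space L^oo and its norm *)

Section Linf_space.
Context (R : realType) (d : measure_display) (Omega : measurableType d).
Context (P : probability Omega R) (n : nat).
Implicit Types (x y z : Omega -> 'rV[R]_n).

Lemma Linf_norm_leP x (c : R) :
  reflect {ae P, forall w, `|x w| <= c} (Linf_norm P x <= c%:E)%E.
Proof.
(* At exponent [+oo] the norm is an essential supremum provided that the total mass is positive. *)
rewrite /Linf_norm unlock /= probability_setT lte01.
apply: (iffP ess_supP); apply: filterS => w /=.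
  by rewrite lee_fin normr_id.
by rewrite lee_fin normr_id.
Qed.

Lemma Linf_norm_ge0 x : (0 <= Linf_norm P x)%E.
Proof. exact: Lnorm_ge0. Qed.

Lemma Linf_normK x : Linf P x -> (fine (Linf_norm P x))%:E = Linf_norm P x.
Proof.
by move=> [_ xoo]; rewrite fineK// fin_numElt xoo andbT (lt_le_trans _ (Linf_norm_ge0 x)).
Qed.

Lemma Linf_norm_ae x : Linf P x ->
  {ae P, forall w, `|x w| <= fine (Linf_norm P x)}.
Proof. by move=> /Linf_normK xE; apply/Linf_norm_leP; rewrite xE. Qed.

Lemma Linf_bounded x (c : R) : L0 x -> {ae P, forall w, `|x w| <= c} ->
  Linf P x.
Proof.
by move=> mx /Linf_norm_leP xc; split => //; rewrite (le_lt_trans xc)// ltry.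
Qed.

Lemma fine_Linf_norm_le x (c : R) : Linf P x ->
  {ae P, forall w, `|x w| <= c} -> fine (Linf_norm P x) <= c.
Proof. by move=> Lx /Linf_norm_leP; rewrite -Linf_normK// lee_fin. Qed.

Lemma subspace_Linf : subspace_set (Linf P (n := n)).
Proof.
split.
  apply: (@Linf_bounded _ 0); last by apply: nearW => w; rewrite normr0.
  move=> i; rewrite (_ : (fun _ => _) = cst 0); first exact: measurable_cst.
  by apply/funext => w /=; rewrite mxE.
move=> a x y Lx Ly.
apply: (@Linf_bounded _ (`|a| * fine (Linf_norm P x) + fine (Linf_norm P y))).
  move=> i; have -> : (fun w => (a *: x + y) w ord0 i) =
      ((fun w => a * x w ord0 i) \+ (fun w => y w ord0 i)).
    by apply/funext => w /=; rewrite !mxE.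
  apply: measurable_funD; last exact: Ly.1.
  by apply: measurable_funM => //; exact: Lx.1.
apply: filterS2 (Linf_norm_ae Lx) (Linf_norm_ae Ly) => w xw yw.
apply: le_trans (ler_normD _ _) _; rewrite lerD// normrZ.
by rewrite ler_wpM2l.
Qed.

(** One inequality suffices: for nonzero a, applying it to [a^-1] and [a *: x] gives the
    converse. *)
Lemma Linf_normZ x (a : R) : Linf P x ->
  fine (Linf_norm P (a *: x)) = `|a| * fine (Linf_norm P x).
Proof.
move=> Lx; have Z := subspace_setZ subspace_Linf.
have le (b : R) y : Linf P y ->
    fine (Linf_norm P (b *: y)) <= `|b| * fine (Linf_norm P y).
  move=> Ly; apply: fine_Linf_norm_le; first exact: Z.
  by apply: filterS (Linf_norm_ae Ly) => w yw; rewrite normrZ ler_wpM2l.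
apply/eqP; rewrite eq_le le//=; have [->|a0] := eqVneq a 0.
  by rewrite normr0 mul0r fine_ge0// Linf_norm_ge0.
rewrite -ler_pdivlMl ?normr_gt0// -normfV.
by rewrite -{1}[x]scale1r -(mulVf a0) -scalerA le//; exact: Z.
Qed.

Lemma Linf_norm_sublinear (K : R) : 0 <= K ->
  sublinear_on (Linf P (n := n)) (fun x => K * fine (Linf_norm P x)).
Proof.
move=> K0; split=> [x y Lx Ly|a x a0 Lx].
  rewrite -mulrDr ler_wpM2l//; apply: fine_Linf_norm_le.
    exact: (subspace_setD subspace_Linf).
  apply: filterS2 (Linf_norm_ae Lx) (Linf_norm_ae Ly) => w xw yw.
  by apply: le_trans (ler_normD _ _) _; rewrite lerD.
by rewrite Linf_normZ// ger0_norm// mulrCA.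
Qed.

Lemma Linf_normN x : Linf_norm P (- x) = Linf_norm P x.
Proof. by rewrite /Linf_norm; apply: eq_Lnorm => w /=; rewrite normrN. Qed.

Lemma Linf_affine_hull (S : set (Omega -> 'rV[R]_n)) :
  S `<=` Linf P (n := n) -> affine_hull S `<=` Linf P (n := n).
Proof.
move=> SL _ [k [a [y [Sy _ ->]]]].
apply: (big_ind (Linf P (n := n))).
- exact: subspace_Linf.1.
- exact: (subspace_setD subspace_Linf).
- by move=> i _; apply: (subspace_setZ subspace_Linf); exact/SL/Sy.
Qed.

End Linf_space.

(** * Adapted processes and the adapted projection *)

Section adapted_processes.
Context (R : realType) (d : measure_display) (Omega : measurableType d).
Context (P : probability Omega R) (N : nat).
Context (F : 'I_N.+1 -> set (set Omega)) (n_ : 'I_N.+1 -> nat).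
Hypothesis filtF : filtration F.
Implicit Types x z : Omega -> 'rV[R]_(\sum_t n_ t).

Let sF t : sigma_algebra setT (F t). Proof. by case: filtF. Qed.
Let FM t : F t `<=` measurable. Proof. by case: filtF. Qed.

Lemma adapted_inf_comb x z (a b : R) : adapted_inf P F x -> adapted_inf P F z ->
  adapted_inf P F (a *: x + b *: z).
Proof.
move=> [ax Lx] [az Lz]; split; last first.
  by apply: (subspace_Linf P _).2 => //; apply: (subspace_setZ (subspace_Linf P _)).
move=> t i.
have -> : (fun w => submxrow ((a *: x + b *: z) w) t ord0 i) =
    ((fun w => a * submxrow (x w) t ord0 i) \+
     (fun w => b * submxrow (z w) t ord0 i))%R.
  by apply/funext => w /=; rewrite !mxE.
apply/measurable_wrtP => //; apply: measurable_funD;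
  by apply: measurable_funM => //; apply/measurable_wrtP; [exact: sF|].
Qed.

Lemma mxrow_norm_le (u : 'rV[R]_(\sum_t n_ t)) (c : R) : 0 <= c ->
  (forall t i, `|submxrow u t ord0 i| <= c) -> `|u| <= c.
Proof.
move=> c0 uc; rewrite [`|u|](mx_normrE u); apply/bigmax_leP; split => // -[i j] _ /=.
by rewrite -[u]submxrowK mxE ord1.
Qed.

Lemma submxrow_norm_le (u : 'rV[R]_(\sum_t n_ t)) t i :
  `|submxrow u t ord0 i| <= `|u|.
Proof.
rewrite mxE [leRHS](mx_normrE u).
exact: (le_bigmax _ (fun ij => `|u ij.1 ij.2|) (ord0, tagnat.Rank t i)).
Qed.

Lemma integrable_Linf_submxrow z t i : Linf P z ->
  P.-integrable setT (EFin \o (fun w => submxrow (z w) t ord0 i)).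
Proof.
move=> Lz; have mz : measurable_fun setT (fun w => submxrow (z w) t ord0 i).
  under eq_fun do rewrite mxE; exact: Lz.1.
apply/integrableP; split; first exact/measurable_EFinP.
apply: le_lt_trans (@integral_le_bound _ _ _ P setT _
  (fine (Linf_norm P z))%:E _ _ _ _) _ => //.
- exact/measurable_EFinP.
- by rewrite lee_fin fine_ge0// Linf_norm_ge0.
- apply: filterS (Linf_norm_ae Lz) => w zw _.
  by rewrite /= lee_fin (le_trans (submxrow_norm_le _ _)).
- by rewrite [X in (_ * X)%E](@probability_setT _ _ _ P) mule1 ltry.
Qed.

(** Both z and its projection are within the norm of z - x from the adapted process x; the factor 2
    is the triangle inequality. *)
Lemma adapted_projection_dist z x : Linf P z -> adapted_inf P F x ->
  (Linf_norm P (adapted_projection P F z - z)%R <=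
   (2 * fine (Linf_norm P (z - x)))%:E)%E.
Proof.
move=> Lz [ax Lx]; set c := fine _.
have Lzx := subspace_setB (subspace_Linf P _) Lz Lx.
have c0 : 0 <= c by rewrite fine_ge0// Linf_norm_ge0.
have dist t i : {ae P, forall w,
    `|cond_exp P (F t) (fun w => submxrow (z w) t ord0 i) w -
      submxrow (x w) t ord0 i| <= c}.
  apply: cond_exp_dist => //; [exact: integrable_Linf_submxrow..|].
  apply: filterS (Linf_norm_ae Lzx) => w zxw; apply: le_trans zxw.
  by have := submxrow_norm_le ((z - x) w) i; rewrite !mxE.
apply/Linf_norm_leP.
(* There are finitely many coordinates, so one null set serves them all. *)
have : {ae P, forall w, forall t i,
    `|cond_exp P (F t) (fun w => submxrow (z w) t ord0 i) w -
      submxrow (x w) t ord0 i| <= c}.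
  by apply: filter_forall => t; apply: filter_forall => i; exact: dist.
apply: filterS2 (Linf_norm_ae Lzx) => w zxw Exw.
apply: mxrow_norm_le => [|t i]; first by rewrite mulr_ge0.
have -> : submxrow ((adapted_projection P F z - z) w) t ord0 i =
    cond_exp P (F t) (fun w => submxrow (z w) t ord0 i) w -
    submxrow (z w) t ord0 i.
  have -> : (adapted_projection P F z - z) w = adapted_projection P F z w - z w.
    by [].
  by rewrite submxrowB mxrowK !mxE.
have : `|submxrow (z w) t ord0 i - submxrow (x w) t ord0 i| <= c.
  by apply: le_trans zxw; have := submxrow_norm_le ((z - x) w) i; rewrite !mxE.
by have := Exw t i; rewrite !ler_norml => /andP[? ?] /andP[? ?]; lra.
Qed.

End adapted_processes.

(** The scalar core of the estimate: [E] is the value of Eh at y, [B] its bound on the ball of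
    radius [delta] around xbar, and [b] bounds the norm of x' - y. For b > 0, taking l = delta / (2
    b) gives l b = delta / 2, and solving for [E] yields the claim. *)
Lemma slope_lower_bound (R : realType) (m B E b delta : R) :
  0 <= b -> 0 < delta -> m <= B ->
  (forall l, 0 < l -> l * b < delta -> (1 + l) * m <= B + l * E) ->
  m - (B - m) * (2 * b / delta) <= E.
Proof.
move=> b0 d0 mB H; move: b0; rewrite le_eqVlt => /predU1P[b0|b0].
  rewrite -b0 mulr0 mul0r mulr0 subr0 leNgt; apply/negP => Em.
  have mE0 : 0 < m - E by rewrite subr_gt0.
  (* With b = 0 every positive l is admissible; this one makes l (m - E) exceed B - m, a
     contradiction. *)
  have l0 : 0 < (B - m + 1) / (m - E) by rewrite divr_gt0//; lra.
  have := H _ l0; rewrite -b0 mulr0 => /(_ d0).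
  have : (B - m + 1) / (m - E) * (m - E) = B - m + 1 by rewrite mulfVK// gt_eqF.
  lra.
have l0 : 0 < delta / (2 * b) by rewrite divr_gt0// mulr_gt0.
set l := delta / (2 * b) in l0 *.
have lb : l * b = delta / 2 by rewrite /l; field; rewrite gt_eqF.
have Hl : (1 + l) * m <= B + l * E by apply: H => //; rewrite lb; lra.
have -> : 2 * b / delta = l^-1 by rewrite /l invf_div.
rewrite lerBlDr -lerBlDl ler_pdivlMr//; lra.
Qed.

(** * Existence of the subgradient *)

Theorem theorem5 (R : realType) (d : measure_display)
    (Omega : measurableType d) (P : probability Omega R)
    (N : nat) (F : 'I_N.+1 -> set (set Omega)) (n_ : 'I_N.+1 -> nat)
    (h : 'rV[R]_(\sum_t n_ t) -> Omega -> \bar R) :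
  filtration F ->
  normal_integrand h ->
  convex_integrand h ->
  let Eh := Eint P h in
  let phi := inf_over Eh (adapted F (n_ := n_)) in
  let phit := inf_over Eh (adapted_inf P F (n_ := n_)) in
  let A := affine_hull ([set x | (Eh x < +oo)%E] `&` Linf P (n := _)) in
  phi 0 \is a fin_num ->
  proper_on_Linf P Eh ->
  (exists rho : R, forall z, A z ->
     exists2 x, (A `&` adapted_inf P F (n_ := n_)) x &
       (Linf_norm P (x - z)%R <=
        rho%:E * Linf_norm P (adapted_projection P F z - z)%R)%E) ->
  (exists2 xbar, (A `&` adapted_inf P F (n_ := n_)) xbar &
     strongly_continuous_at_relative P Eh A xbar) ->
  strongly_subdifferentiable_at0 P phit.
Proof.
move=> filtF nh ch Eh phi phit A phi0 [Ehgt _] [rho Hrho].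
move=> [xbar [Axbar Nxbar] [Ehxbar Hcont]].
have sL := subspace_Linf P (\sum_t n_ t).
have AL : A `<=` Linf P (n := _) by apply: Linf_affine_hull => x [].
have Ehfin y : (Eh y < +oo)%E -> Linf P y -> Eh y \is a fin_num.
  by move=> yoo Ly; rewrite fin_numElt yoo Ehgt.
have phit_le x : adapted_inf P F x -> (phit 0%R <= Eh x)%E.
  by move=> Nx; apply: ereal_inf_lbound; exists x => //=; rewrite addr0.
have phit0 : phit 0 \is a fin_num.
  rewrite fin_numElt; apply/andP; split; last first.
    by rewrite (le_lt_trans (phit_le _ Nxbar))// ltey_eq Ehxbar.
  (* Restricting the infimum to bounded processes can only raise it, so finiteness of [phi 0]
     excludes [-oo]. *)
  apply: (@lt_le_trans _ _ (phi 0)); first by rewrite ltNye_eq phi0.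
  by apply: ereal_inf_le_tmp => _ [x [ax _] <-]; exists x.
set m := fine (phit 0).
have mE : m%:E = phit 0 by rewrite fineK.
have convEh x y a b : Linf P x -> Linf P y -> Eh x \is a fin_num ->
    Eh y \is a fin_num -> 0 <= a -> 0 <= b -> a + b = 1 ->
    (Eh (a *: x + b *: y)%R <= (a * fine (Eh x) + b * fine (Eh y))%:E)%E.
  move=> Lx Ly fx fy a0 b0 ab; rewrite EFinD !EFinM !fineK//.
  by apply: Eint_convex => //; [exact: Lx.1|exact: Ly.1].
(* Continuity enters only through tolerance 1, as an upper bound on a ball relative to [A]. *)
have [delta delta0 Hdelta] := Hcont 1 ltr01.
pose B := fine (Eh xbar) + 1.
have mB : m <= B.
  by have := phit_le _ Nxbar; rewrite -mE -(fineK Ehxbar) lee_fin /B; lra.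
have HB z : A z -> fine (Linf_norm P (z - xbar)) < delta ->
    Eh z \is a fin_num /\ fine (Eh z) <= B.
  move=> Az zd; have := Hdelta z Az.
  rewrite -Linf_normK; last exact: (subspace_setB sL (AL _ Az) Nxbar.2).
  rewrite lte_fin => /(_ zd); rewrite -(fineK Ehxbar).
  case: (Eh z) => [r| |]//=; rewrite -?EFinB ?abse_EFin ?lte_fin.
  by rewrite ltr_norml /B => /andP[_]; split => //; lra.
(* This is the slope of [slope_lower_bound] for b = 2 |rho| c, divided by c, the norm of y - x. The
   absolute value covers a negative [rho]. *)
pose K := (B - m) * (2 * (`|rho| * 2) / delta).
have K0 : 0 <= K by rewrite mulr_ge0 ?subr_ge0// divr_ge0 ?mulr_ge0// ltW.
have key y x : (Eh y < +oo)%E -> Linf P y -> adapted_inf P F x ->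
    m - K * fine (Linf_norm P (y - x)) <= fine (Eh y).
  move=> yoo Ly Nx; have fy := Ehfin _ yoo Ly.
  have Ay : A y by apply: subset_affine_hull.
  have [x' [Ax' Nx'] x'y] := Hrho y Ay.
  set c := fine (Linf_norm P (y - x)).
  have c0 : 0 <= c by rewrite fine_ge0// Linf_norm_ge0.
  have Lx'y := subspace_setB sL Nx'.2 Ly.
  have x'yc : fine (Linf_norm P (x' - y)) <= `|rho| * 2 * c.
    rewrite -lee_fin Linf_normK//; apply: (le_trans x'y).
    rewrite -mulrA EFinM; apply: (@le_trans _ _
      (`|rho|%:E * Linf_norm P (adapted_projection P F y - y)%R)%E).
      by rewrite lee_wpmul2r ?Linf_norm_ge0// lee_fin ler_norm.
    by rewrite lee_wpmul2l//; exact: adapted_projection_dist.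
  have -> : K * c = (B - m) * (2 * (`|rho| * 2 * c) / delta).
    by rewrite /K; ring.
  apply: slope_lower_bound => // [|l l0 lb]; first by rewrite !mulr_ge0.
  pose w := xbar + l *: (x' - y).
  have Aw : A w by exact: affine_hull_translate.
  have [fw wB] : Eh w \is a fin_num /\ fine (Eh w) <= B.
    apply: HB => //; rewrite /w addrC addKr Linf_normZ// gtr0_norm//.
    by apply: le_lt_trans lb; rewrite ler_pM2l.
  have l10 : 0 < 1 + l by rewrite addr_gt0.
  (* The multiples of y cancel: convexity bounds Eh of the left side from above, while the right
     side is adapted, so Eh there is at least [m]. *)
  have avgE : (1 + l)^-1 *: w + (l / (1 + l)) *: y =
      (1 + l)^-1 *: xbar + (l / (1 + l)) *: x'.
    by rewrite /w scalerDr scalerA [_ * l]mulrC -addrA -scalerDr subrK.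
  have := phit_le _ (adapted_inf_comb filtF (1 + l)^-1 (l / (1 + l)) Nxbar Nx').
  rewrite -avgE => /le_trans/(_ (convEh _ _ _ _ (AL _ Aw) Ly fw fy _ _ _)).
  rewrite -mE lee_fin => H.
  have {}H : m <= (1 + l)^-1 * fine (Eh w) + l / (1 + l) * fine (Eh y).
    apply: H; rewrite ?invr_ge0 ?divr_ge0 ?ltW//.
    by rewrite -{1}[(1 + l)^-1]mul1r -mulrDl divff// gt_eqF.
  have : (1 + l) * m <= fine (Eh w) + l * fine (Eh y).
    rewrite -ler_pdivlMl//; apply: le_trans H _.
    by rewrite mulrDr mulrA [l / _]mulrC.
  by lra.
(* Essentially the epigraph of z |-> phit z - m, but with an explicit witness x, so that no infimum
   has to be attained. It inherits convexity from Eh. *)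
pose C := [set p : (Omega -> 'rV[R]_(\sum_t n_ t)) * R | Linf P p.1 /\
  exists2 x, adapted_inf P F x & (Eh (x + p.1)%R <= (m + p.2)%:E)%E].
have [] := @hahn_banach_sandwich R _ _ sL (fun z => K * fine (Linf_norm P z)) C.
- exact: Linf_norm_sublinear.
- exists (0, fine (Eh xbar) - m); split; first exact: sL.1.
  by exists xbar => //=; rewrite addr0 addrC subrK fineK.
- by move=> z a [].
(* The bound [key] is used at y = x + z, whose difference from x is z. *)
- move=> z a [/= Lz [x Nx Exz]]; rewrite Linf_normN.
  have Lxz := subspace_setD sL Nx.2 Lz.
  have xzoo := le_lt_trans Exz (ltry _).
  have := key _ _ xzoo Lxz Nx; rewrite addrAC subrr add0r.
  move: Exz; rewrite -(fineK (Ehfin _ xzoo Lxz)) lee_fin; lra.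
- move=> z a z' a' s s' [/= Lz [x Nx Exz]] [/= Lz' [x' Nx' Exz']] s0 s'0 ss'.
  split; first by apply: sL.2 => //; exact: (subspace_setZ sL).
  exists (s *: x + s' *: x'); first exact: adapted_inf_comb.
  have Lxz := subspace_setD sL Nx.2 Lz.
  have Lxz' := subspace_setD sL Nx'.2 Lz'.
  have fxz := Ehfin _ (le_lt_trans Exz (ltry _)) Lxz.
  have fxz' := Ehfin _ (le_lt_trans Exz' (ltry _)) Lxz'.
  rewrite /= addrACA -!scalerDr.
  apply: le_trans (convEh _ _ _ _ Lxz Lxz' fxz fxz' (ltW s0) (ltW s'0) ss') _.
  move: Exz Exz'; rewrite -(fineK fxz) -(fineK fxz') !lee_fin => h1 h2.
  have -> : m + (s * a + s' * a') = s * (m + a) + s' * (m + a').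
    by rewrite !mulrDr addrACA -mulrDl ss' mul1r.
  by rewrite lerD// ler_wpM2l// ltW.
move=> v vlin [vK vC]; split => //; exists v.
(* The upper bound at - z supplies the lower bound at z, so [K] bounds the dual norm. *)
- split => //; exists K => z Lz; rewrite -Linf_normK// -EFinM lee_fin ler_norml.
  rewrite vK// andbT; have := vK _ (subspace_setN sL Lz); rewrite Linf_normN.
  have v0 : v 0 = 0 by have := vlin 1 0 0 sL.1 sL.1; rewrite scaler0 addr0; lra.
  have := vlin (-1) z 0 Lz sL.1; rewrite addr0 scaleN1r v0; lra.
(* For each x with Eh (x + z) finite, the pair (z, Eh (x + z) - m) lies in [C]; an infinite value
   makes the inequality trivial. *)
- move=> z Lz; apply: le_ereal_inf_tmp => _ [x Nx <-].
  have Lxz := subspace_setD sL Nx.2 Lz.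
  have [xzoo|] := ltP (Eh (x + z)) +oo%E; last first.
    by rewrite leye_eq => /eqP ->; rewrite leey.
  have fxz := Ehfin _ xzoo Lxz.
  rewrite -mE -(fineK fxz) -EFinD lee_fin -lerBrDl.
  by apply: vC; split => //=; exists x => //; rewrite [m + _]addrC subrK fineK.
Qed.
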